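(* Let $\lambda\ge 0$ and let $(\mathcal{V}^h(t),\varkappa^h(t),\vec X^h(t),\kappa^h(t))\in V^h\times V^h\times[V^h]^2\times V^h$, $t\in(0,T]$, be a solution of the semidiscrete scheme (S) defined in the context, with $|\vec X^h_\rho|>0$ in $\mathbb{I}$ for all $t\in[0,T]$. Then $$\frac{\rm d}{{\rm d}t}\Bigl[\tfrac12\bigl((\varkappa^h)^2,\,|\vec X^h_\rho|\bigr)+\lambda\,|\Gamma^h(t)|\Bigr]=-\bigl(\mathcal{V}^h,\,\mathcal{V}^h\,|\vec X^h_\rho|\bigr)\le 0,$$ where $|\Gamma^h(t)|=\int_{\mathbb I}|\vec X^h_\rho|\,{\rm d}\rho$ is the length of the polygonal curve $\Gamma^h(t)=\vec X^h(\mathbb{I},t)$.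
   Context: $\mathbb{I}=\mathbb{R}/\mathbb{Z}$ is partitioned uniformly into $\mathbb{I}_j=[\rho_{j-1},\rho_j]$, $j=1,\dots,J$, with $\rho_j=jh$, $h=1/J$ ($\rho_0$ and $\rho_J$ are identified). $V^h=\{\chi\in C^0(\mathbb{I}):\chi|_{\mathbb{I}_j}\text{ is affine for } j=1,\dots,J\}$. $(\cdot,\cdot)$ is the $L^2$-inner product over $\mathbb{I}$ (for scalar or vector valued functions), and the mass-lumped inner product is $$(u,v)^h=\frac h2\sum_{j=1}^J\bigl[(u\cdot v)(\rho_j^-)+(u\cdot v)(\rho_{j-1}^+)\bigr],$$ for piecewise continuous $u,v$ with possible jumps at the nodes, where $u(\rho_j^\pm)=\lim_{\delta\searrow0}u(\rho_j\pm\delta)$. Subscripts $\rho,t$ denote partial derivatives. $(\cdot)^\perp$ denotes clockwise rotation by $\pi/2$. For $\vec X^h(t)\in[V^h]^2$ with $|\vec X^h_\rho|>0$ set $\vec\tau^h=\vec X^h_\rho\,|\vec X^h_\rho|^{-1}$ and $\vec\nu^h=-(\vec\tau^h)^\perp$. Semidiscrete scheme (S): given initial data $\vec X^h(0)\in[V^h]^2$ and $\varkappa^h(0)\in V^h$, for each $t\in(0,T]$ find $\mathcal{V}^h(t)\in V^h$, $\varkappa^h(t)\in V^h$, $\vec X^h(t)\in[V^h]^2$, $\kappa^h(t)\in V^h$ such that $$\bigl(\mathcal{V}^h,\varphi^h|\vec X^h_\rho|\bigr)=\bigl(\varkappa^h_\rho,\varphi^h_\rho|\vec X^h_\rho|^{-1}\bigr)-\tfrac12\bigl((\varkappa^h)^3,\varphi^h|\vec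 X^h_\rho|\bigr)+\lambda\bigl(\kappa^h,\varphi^h|\vec X^h_\rho|\bigr)\quad\forall\varphi^h\in V^h,$$ $$\bigl(\varkappa^h_t,\chi^h|\vec X^h_\rho|\bigr)+\tfrac12\bigl([\vec X^h_t]_\rho\cdot\vec\tau^h,\varkappa^h\chi^h\bigr)=-\bigl(\mathcal{V}^h_\rho,\chi^h_\rho|\vec X^h_\rho|^{-1}\bigr)+\tfrac12\bigl(\mathcal{V}^h(\varkappa^h)^2,\chi^h|\vec X^h_\rho|\bigr)+\tfrac12\bigl(\vec X^h_t\cdot\vec\tau^h,\ \varkappa^h_\rho\chi^h-\varkappa^h\chi^h_\rho\bigr)\quad\forall\chi^h\in V^h,$$ $$\bigl(\vec\nu^h\cdot\vec X^h_t,\xi^h|\vec X^h_\rho|\bigr)^h=\bigl(\mathcal{V}^h,\xi^h|\vec X^h_\rho|\bigr)\quad\forall\xi^h\in V^h,$$ $$\bigl(\kappa^h\vec\nu^h,\vec\eta^h|\vec X^h_\rho|\bigr)^h=-\bigl(\vec X^h_\rho,\vec\eta^h_\rho|\vec X^h_\rho|^{-1}\bigr)\quad\forall\vec\eta^h\in[V^h]^2.$$ A solution is understood to have nodal values of $\vec X^h$ and $\varkappa^h$ that are differentiable in $t$. Note that $\varkappa^h$ and $\kappa^h$ are two independent unknowns, and $V^h$ (a space) is different from $\mathcal{V}^h$ (an unknown function). *)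

(* Defs.v *)
From mathcomp Require Import all_boot all_order all_algebra.
From mathcomp Require Import all_classical all_reals all_analysis.
Import Order.TTheory GRing.Theory Num.Theory.
Import numFieldNormedType.Exports.

Set Implicit Arguments.
Unset Strict Implicit.
Unset Printing Implicit Defensive.

Local Open Scope classical_set_scope.
Local Open Scope ring_scope.

Section plane.
Variable R : realType.

(* The library norm on 'rV[R]_2 is the sup norm; lengths need the Euclidean
   one. *)
Definition dot (u v : 'rV[R]_2) : R := \sum_(i < 2) u 0 i * v 0 i.
Definition enorm (u : 'rV[R]_2) : R := Num.sqrt (dot u u).

(* clockwise rotation by pi / 2: (a, b) |-> (b, - a) *)
Definition perp (u : 'rV[R]_2) : 'rV[R]_2 :=
  \row_(i < 2) (if i == 0 then u 0 1 else - u 0 0).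

End plane.

(* Functions on the circle R / Z are 1-periodic functions on R. The derivative
   of a piecewise affine function has a meaningless value at the nodes; this
   does not affect the integrals, nor the one-sided limits in [ip_h]. *)
Section finite_elements.
Variable R : realType.
Variable J : nat.

Definition mesh : R := J%:R^-1.
Definition node (j : nat) : R := j%:R * mesh.

(* The element [set` `[node j, node j.+1]], j < J, is I_(j+1). *)
Definition Vh : set (R -> R) := [set f : R -> R |
  [/\ periodic f 1, continuous f &
      forall j, (j < J)%N ->
        exists a b : R, forall x, x \in `[node j, node j.+1] ->
          f x = a + b * x]].

Definition Vh2 : set (R -> 'rV[R]_2) :=
  [set X : R -> 'rV[R]_2 | forall i, Vh (fun x => X x 0 i)].

Definition integral01 (w : R -> R) : R :=
  \int[@lebesgue_measure R]_(x in `[0, 1]) w x.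

Definition ip (u v : R -> R) : R := integral01 (fun x => u x * v x).
Definition vip (u v : R -> 'rV[R]_2) : R :=
  integral01 (fun x => dot (u x) (v x)).

Definition lumped (w : R -> R) : R :=
  mesh / 2 * \sum_(j < J)
    (lim (w x @[x --> (node j.+1)^'-]) + lim (w x @[x --> (node j)^'+])).

Definition ip_h (u v : R -> R) : R := lumped (fun x => u x * v x).
Definition vip_h (u v : R -> 'rV[R]_2) : R :=
  lumped (fun x => dot (u x) (v x)).

Definition speed (X : R -> 'rV[R]_2) (x : R) : R := enorm (derive1 X x).
Definition tangent (X : R -> 'rV[R]_2) (x : R) : 'rV[R]_2 :=
  (speed X x)^-1 *: derive1 X x.
Definition normal (X : R -> 'rV[R]_2) (x : R) : 'rV[R]_2 :=
  - perp (tangent X x).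
Definition curve_length (X : R -> 'rV[R]_2) : R := integral01 (speed X).

(* X_rho is constant on the interior of each element and undefined at the
   nodes, hence the open elements. *)
Definition regular (X : R -> 'rV[R]_2) : Prop :=
  forall j, (j < J)%N -> forall x, x \in `]node j, node j.+1[ -> 0 < speed X x.

End finite_elements.

(* Time derivative on [0, T]: the difference quotient only sees times in
   [0, T], so that it is two-sided on ]0, T[ and one-sided at T. *)
Section time_derivative.
Variables (R : realType) (V : normedModType R) (T : R).

Definition tquot (f : R -> V) (t s : R) : V := (s - t)^-1 *: (f s - f t).
Definition has_tderive (f : R -> V) (t : R) (l : V) : Prop :=
  tquot f t s @[s --> within `[0, T] t^'] --> l.
Definition tderivable (f : R -> V) (t : R) : Prop :=
  cvg (tquot f t s @[s --> within `[0, T] t^']).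
Definition tderive (f : R -> V) (t : R) : V :=
  lim (tquot f t s @[s --> within `[0, T] t^']).

End time_derivative.

(* The unknowns take the time first and the space variable second. VV is the
   normal velocity, vk and k are the two independent discrete curvatures. *)
Record semidiscrete_solution (R : realType) (J : nat) (lambda T : R)
    (X0 : R -> 'rV[R]_2) (vk0 : R -> R)
    (VV vk : R -> R -> R) (X : R -> R -> 'rV[R]_2) (k : R -> R -> R) : Prop :=
  SemidiscreteSolution {
  sol_X_init : X 0 = X0;
  sol_vk_init : vk 0 = vk0;
  sol_VV_mem : forall t : R, t \in `]0, T] -> Vh J (VV t);
  sol_vk_mem : forall t : R, t \in `]0, T] -> Vh J (vk t);
  sol_X_mem : forall t : R, t \in `]0, T] -> Vh2 J (X t);
  sol_k_mem : forall t : R, t \in `]0, T] -> Vh J (k t);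
  sol_X_diff : forall t : R, t \in `]0, T] -> forall j, (j <= J)%N ->
    tderivable T (fun s => X s (node R J j)) t;
  sol_vk_diff : forall t : R, t \in `]0, T] -> forall j, (j <= J)%N ->
    tderivable T (fun s => vk s (node R J j)) t;
  sol_velocity : forall t : R, t \in `]0, T] -> forall phi, Vh J phi ->
    ip (VV t) (fun x => phi x * speed (X t) x)
    = ip (derive1 (vk t)) (fun x => derive1 phi x * (speed (X t) x)^-1)
      - 2^-1 * ip (fun x => vk t x ^+ 3) (fun x => phi x * speed (X t) x)
      + lambda * ip (k t) (fun x => phi x * speed (X t) x);
  sol_curvature : forall t : R, t \in `]0, T] -> forall chi, Vh J chi ->
    let X_t := fun x => tderive T (fun s => X s x) t in
    let vk_t := fun x => tderive T (fun s => vk s x) t in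
    ip vk_t (fun x => chi x * speed (X t) x)
      + 2^-1 * ip (fun x => dot (derive1 X_t x) (tangent (X t) x))
                  (fun x => vk t x * chi x)
    = - ip (derive1 (VV t)) (fun x => derive1 chi x * (speed (X t) x)^-1)
      + 2^-1 * ip (fun x => VV t x * vk t x ^+ 2)
                  (fun x => chi x * speed (X t) x)
      + 2^-1 * ip (fun x => dot (X_t x) (tangent (X t) x))
                  (fun x => derive1 (vk t) x * chi x - vk t x * derive1 chi x);
  sol_motion : forall t : R, t \in `]0, T] -> forall xi, Vh J xi ->
    let X_t := fun x => tderive T (fun s => X s x) t in
    ip_h J (fun x => dot (normal (X t) x) (X_t x))
           (fun x => xi x * speed (X t) x)
    = ip (VV t) (fun x => xi x * speed (X t) x);
  sol_equidistribution : forall t : R, t \in `]0, T] ->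
    forall eta, Vh2 J eta ->
    vip_h J (fun x => k t x *: normal (X t) x)
            (fun x => speed (X t) x *: eta x)
    = - vip (derive1 (X t)) (fun x => (speed (X t) x)^-1 *: derive1 eta x)
}.

(* Main.v *)
(* Test the second equation of (S) with vk, the first with VV, the
   equidistribution property with eta = X_t and the motion law with xi = k: all
   terms cancel except the time derivative of the energy and - (VV, VV |X_rho|).
   The energy is differentiated through its elementwise expression in the nodal
   values, since X_rho is constant on each element. The point to check is that
   X_t is an admissible test function: it is a pointwise limit of difference
   quotients in Vh, and Vh is closed under pointwise limits. *)
Require Import Defs.
From mathcomp Require Import all_boot all_order all_algebra.
From mathcomp Require Import all_classical all_reals all_analysis.
From mathcomp Require Import measurable_realfun ring lra.
Import Order.TTheory GRing.Theory Num.Theory.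
Import numFieldNormedType.Exports.

Set Implicit Arguments.
Unset Strict Implicit.
Unset Printing Implicit Defensive.

Local Open Scope classical_set_scope.
Local Open Scope ring_scope.

(** * Integrals of functions known only inside an interval, and their concatenation *)

Section piecewise_integration.
Variable R : realType.
Local Notation mu := (@lebesgue_measure R).
Implicit Types (a b c v : R) (w f F : R -> R).

(** Integrability is bundled with the value because additivity over adjacent intervals requires
    it. *)
Definition has_integral a b w v : Prop :=
  mu.-integrable `[a, b] (EFin \o w) /\ \int[mu]_(x in `[a, b]) w x = v.

(** The integrand [w] is compared with [f] on the open interval only: derivatives of finite element
    functions are uncontrolled at the nodes, and two points have measure zero. *)
Lemma has_integral_FTC a b w f F : a < b -> continuous f ->
  (forall x, is_derive x (1 : R) F (f x)) ->
  {in `]a, b[, w =1 f} -> has_integral a b w (F b - F a).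
Proof.
move=> ab cf dF wf.
have intf : mu.-integrable `[a, b] (EFin \o f).
  apply: continuous_compact_integrable; first exact: segment_compact.
  exact: continuous_subspaceT.
have mf : measurable_fun `]a, b[ f.
  apply: open_continuous_measurable_fun; first exact: interval_open.
  by move=> x _; exact: cf.
have mw : measurable_fun `]a, b[ w.
  by apply: eq_measurable_fun mf => x; rewrite inE => /wf.
have mw' : measurable_fun `[a, b] w.
  exact/measurable_fun_itv_obnd_cbndP/measurable_fun_itv_bndo_bndcP.
(* The map [h] is later the absolute value, for integrability, and the identity, for the value of
   the integral. *)
have intE g (h : \bar R -> \bar R) : measurable_fun setT h ->
  measurable_fun `]a, b[ g ->
  (\int[mu]_(x in `[a, b]) h (g x)%:E = \int[mu]_(x in `]a, b[) h (g x)%:E)%E.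
  move=> mh mg; apply: integral_itv_bndoo.
  by apply: measurableT_comp => //; exact/measurable_EFinP.
have wfE h : measurable_fun setT h ->
   (\int[mu]_(x in `[a, b]) h (w x)%:E = \int[mu]_(x in `[a, b]) h (f x)%:E)%E.
  move=> mh; rewrite !intE//; apply: eq_integral => x.
  by rewrite inE => /wf ->.
split.
  apply/integrableP; split; first exact/measurable_EFinP.
  rewrite (wfE (fun x => `|x|%E)); last exact: abse_measurable.
  by case/integrableP: intf.
rewrite /Rintegral (wfE id)//.
rewrite (@continuous_FTC2 _ f F)//.
- exact: continuous_subspaceT.
- have cF : continuous F.
    move=> x; apply/differentiable_continuous; rewrite -derivable1_diffP.
    exact: (@ex_derive _ _ _ _ _ _ _ (dF x)).
  split.
  + by move=> x _; exact: (@ex_derive _ _ _ _ _ _ _ (dF x)).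
  + exact/cvg_at_right_filter/cF.
  + exact/cvg_at_left_filter/cF.
- by move=> x _; rewrite derive1E derive_val.
Qed.

Lemma integrableU_disjoint (A B : set R) w : measurable A -> measurable B ->
  [disjoint A & B] -> mu.-integrable A (EFin \o w) ->
  mu.-integrable B (EFin \o w) -> mu.-integrable (A `|` B) (EFin \o w).
Proof.
move=> mA mB AB /integrableP[mwA iA] /integrableP[mwB iB].
have mw : measurable_fun (A `|` B) (EFin \o w) by exact/measurable_funU.
apply/integrableP; split => //.
rewrite ge0_integral_setU//; first exact: lte_add_pinfty.
by apply: measurableT_comp => //; exact: abse_measurable.
Qed.

Lemma has_integral_join a b c w u v : a <= b -> b <= c ->
  has_integral a b w u -> has_integral b c w v -> has_integral a c w (u + v).
Proof.
move=> ab bc [iab <-] [ibc <-].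
(* The common endpoint [b] is removed from the second interval to make the union disjoint. *)
have ibc' : mu.-integrable `]b, c] (EFin \o w).
  by apply: integrableS ibc => //; apply: subset_itvr; rewrite bnd_simp.
have acE : `[a, c]%classic = `[a, b]%classic `|` `]b, c]%classic.
  by rewrite -itv_bndbnd_setU ?bnd_simp.
have disj : [disjoint `[a, b]%classic & `]b, c]%classic].
  apply/disj_setPS => y [/=]; rewrite !in_itv/= => /andP[_ yb] /andP[].
  by rewrite ltNge yb.
rewrite /has_integral acE; split; first exact: integrableU_disjoint.
rewrite Rintegral_setU//; last exact: integrableU_disjoint.
by rewrite Rintegral_itv_obnd_cbnd.
Qed.

End piecewise_integration.

(** * Integration over the whole circle, element by element *)

Section elements.
Variable R : realType.

Lemma integral01_elements (J : nat) (w : R -> R) (v : nat -> R) : (0 < J)%N ->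
  (forall j, (j < J)%N -> has_integral (node R J j) (node R J j.+1) w (v j)) ->
  integral01 w = \sum_(j < J) v j.
Proof.
move=> J0 Hv.
have nodeS i j : (i <= j)%N -> node R J i <= node R J j.
  by move=> ij; rewrite /node ler_wpM2r ?invr_ge0// ler_nat.
have [_] : has_integral (node R J 0) (node R J J) w (\sum_(j < J) v j).
  (* Induction on the number [n.+1] of elements joined so far; [J.-1] then covers [0, 1], since node
     0 is 0 and node [J] is 1. *)
  have: forall n, (n < J)%N ->
    has_integral (node R J 0) (node R J n.+1) w (\sum_(j < n.+1) v j).
    elim=> [|n IH] nJ; first by rewrite big_ord1; exact: Hv.
    rewrite big_ord_recr; apply: has_integral_join (IH _) (Hv _ _) => //.
    - exact: nodeS.
    - exact: nodeS.
    - exact: ltnW.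
  by move=> /(_ J.-1); rewrite prednK//; apply.
by rewrite /node mul0r mulfV // pnatr_eq0 -lt0n.
Qed.

(** The value is [c] times the element mass matrix h/6 [[2, 1], [1, 2]] applied to the endpoint
    values of the two affine factors. *)
Lemma has_integral_affine2 (a b c u0 u1 w0 w1 : R) (w : R -> R) : a < b ->
  {in `]a, b[, forall x, w x = c
     * ((1 - (x - a) / (b - a)) * u0 + (x - a) / (b - a) * u1)
     * ((1 - (x - a) / (b - a)) * w0 + (x - a) / (b - a) * w1)} ->
  has_integral a b w
    (c * (b - a) / 6 * (2 * u0 * w0 + u0 * w1 + u1 * w0 + 2 * u1 * w1)).
Proof.
move=> ab wE.
have ba0 : b - a != 0 by rewrite subr_eq0 gt_eqF.
set h := b - a.
(* Coefficients of the quadratic integrand in powers of [x - a]; [F] is its primitive vanishing at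
   [a]. *)
pose al := c * u0 * w0.
pose be := c * (u0 * (w1 - w0) + w0 * (u1 - u0)) / h.
pose ga := c * (u1 - u0) * (w1 - w0) / h ^+ 2.
pose f x : R := al + be * (x - a) + ga * (x - a) ^+ 2.
pose F x : R := al * (x - a) + be / 2 * (x - a) ^+ 2 + ga / 3 * (x - a) ^+ 3.
have -> : c * (b - a) / 6 * (2 * u0 * w0 + u0 * w1 + u1 * w0 + 2 * u1 * w1)
   = F b - F a.
  by rewrite /F /al /be /ga /h; field.
apply: (@has_integral_FTC _ _ _ _ f) => //.
- move=> x; apply/differentiable_continuous; rewrite -derivable1_diffP.
  by apply: ex_derive.
- move=> x; apply: is_derive_eq; rewrite /f /GRing.scale/=; lra.
- by move=> x /wE ->; rewrite /f /al /be /ga /h; field.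
Qed.

End elements.

(** * Differential calculus for time derivatives relative to [0, T] *)

Section time_calculus.
Variables (R : realType) (T t : R).
Hypothesis tT : t \in `]0, T].
Local Notation F := (within `[0, T] t^').

(** Since 0 < t <= T, times slightly smaller than [t] lie in [0, T]; approaching from the left also
    covers t = T. *)
Lemma time_filter_proper : ProperFilter F.
Proof.
have FF : Filter F by exact: within_filter.
apply: Build_ProperFilter => //; rewrite /= /within/= => F0.
have := tT; rewrite in_itv/= => /andP[t0 tleT].
have : \forall s \near t^'-, False.
  rewrite near_withinE; near=> s => st.
  have : s != t -> s \in `[0, T] -> False by near: s; exact: F0.
  apply; first by rewrite lt_eqF.
  rewrite in_itv/= (le_trans (ltW st) tleT) andbT ltW//.
  by near: s; exact: lt_nbhsr.
by move/filter_not_empty.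
Unshelve. all: by end_near. Qed.

Section normed.
Variable V : normedModType R.
Implicit Types (f g : R -> V) (l : V).

Lemma tderivableP f : tderivable T f t -> has_tderive T f t (tderive T f t).
Proof. by []. Qed.

Lemma near_time (P : set R) :
  {in `[0, T], forall s, P s} -> \forall s \near F, P s.
Proof. by move=> HP; apply: filterS (withinT _ _) => s; exact: HP. Qed.

Lemma has_tderive_eq f g l : {in `[0, T], f =1 g} ->
  has_tderive T f t l -> has_tderive T g t l.
Proof.
move=> fg; rewrite /has_tderive; apply: cvg_trans; apply: near_eq_cvg.
(* The difference quotient involves the value at [t] too, so the functions must agree there as
   well. *)
have tT' : t \in `[0, T].
  by have := tT; rewrite !in_itv/= => /andP[/ltW -> ->].
by apply: near_time => s sT; rewrite /tquot !fg.
Qed.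

Lemma has_tderive_cst l : has_tderive T (fun=> l) t 0.
Proof.
by apply: cvg_near_cst; apply: nearW => s; rewrite /tquot subrr scaler0.
Qed.

Lemma has_tderiveD f g l m : has_tderive T f t l -> has_tderive T g t m ->
  has_tderive T (fun s => f s + g s) t (l + m).
Proof.
move=> fl gm; rewrite /has_tderive.
have -> : tquot (fun s => f s + g s) t = (fun s => tquot f t s + tquot g t s).
  by apply/funext => s; rewrite /tquot -scalerDr opprD addrACA.
exact: cvgD.
Qed.

Lemma has_tderiveZ (a : R) f l : has_tderive T f t l ->
  has_tderive T (fun s => a *: f s) t (a *: l).
Proof.
move=> fl; rewrite /has_tderive.
have -> : tquot (fun s => a *: f s) t = (fun s => a *: tquot f t s).
  by apply/funext => s; rewrite /tquot -scalerBr !scalerA mulrC.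
exact: cvgZr.
Qed.

Lemma has_tderiveB f g l m : has_tderive T f t l -> has_tderive T g t m ->
  has_tderive T (fun s => f s - g s) t (l - m).
Proof.
move=> fl /(has_tderiveZ (a := -1)); rewrite scaleN1r => /(has_tderiveD fl).
by under eq_fun do rewrite scaleN1r.
Qed.

Lemma has_tderive_sum n (f : 'I_n -> R -> V) (l : 'I_n -> V) :
  (forall i, has_tderive T (f i) t (l i)) ->
  has_tderive T (fun s => \sum_(i < n) f i s) t (\sum_(i < n) l i).
Proof.
elim: n f l => [|n IH] f l fl.
  by rewrite big_ord0; under eq_fun do rewrite big_ord0; exact: has_tderive_cst.
rewrite big_ord_recr/=; under eq_fun do rewrite big_ord_recr/=.
by apply: has_tderiveD => //; exact: IH.
Qed.

(** Away from s = t, f(s) equals (s - t) times the difference quotient plus f(t), and the first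
    summand tends to 0. *)
Lemma has_tderive_cvg f l : has_tderive T f t l -> f s @[s --> F] --> f t.
Proof.
move=> fl.
have st : s @[s --> F] --> t.
  apply: cvg_trans (cvg_within _) _.
  exact: cvg_within.
have h : (s - t) *: tquot f t s @[s --> F] --> (t - t) *: l.
  by apply: cvgZ => //; apply: cvgB => //; exact: cvg_cst.
have : (s - t) *: tquot f t s + f t @[s --> F] --> (t - t) *: l + f t.
  by apply: cvgD => //; exact: cvg_cst.
rewrite subrr scale0r add0r; apply: cvg_trans; apply: near_eq_cvg.
have : \forall s \near F, s != t.
  by rewrite near_withinE; apply: filterS (nbhs_dnbhs_neq t).
apply: filterS => s st0.
by rewrite /tquot scalerA mulfV ?subr_eq0// scale1r subrK.
Qed.

End normed.

(** The increment of the product is split as (f(s) - f(t)) g(s) + f(t) (g(s) - g(t)); continuity of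
    [g] at [t] handles the first factor pair. *)
Lemma has_tderiveM (f g : R -> R) l m : has_tderive T f t l ->
  has_tderive T g t m ->
  has_tderive T (fun s => f s * g s : R) t (l * g t + f t * m : R).
Proof.
move=> fl gm; rewrite /has_tderive.
have -> : tquot (fun s => f s * g s : R) t =
    (fun s => tquot f t s * g s + f t * tquot g t s).
  by apply/funext => s; rewrite /tquot /GRing.scale/=; ring.
apply: cvgD; apply: cvgM => //; last exact: cvg_cst.
exact: has_tderive_cvg gm.
Qed.

Lemma has_tderive_sqrt (f : R -> R) l : (forall s, 0 <= f s) -> 0 < f t ->
  has_tderive T f t l ->
  has_tderive T (fun s => Num.sqrt (f s) : R) t (l / (2 * Num.sqrt (f t)) : R).
Proof.
move=> f0 ft0 fl; rewrite /has_tderive.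
have q0 : 0 < Num.sqrt (f t) by rewrite sqrtr_gt0.
(* The quotient is rationalised by the conjugate sum, which tends to twice the positive root at [t].
   Nonnegativity of [f] makes the squares of the roots equal to its values. *)
have -> : tquot (fun s => Num.sqrt (f s) : R) t =
    (fun s => tquot f t s / (Num.sqrt (f s) + Num.sqrt (f t))).
  apply/funext => s; rewrite /tquot /GRing.scale/=.
  have qs : 0 < Num.sqrt (f s) + Num.sqrt (f t) by rewrite ltr_wpDl// sqrtr_ge0.
  have -> : f s - f t = (Num.sqrt (f s) - Num.sqrt (f t))
      * (Num.sqrt (f s) + Num.sqrt (f t)) by rewrite -subr_sqr !sqr_sqrtr.
  by rewrite mulrA mulfK// gt_eqF.
apply: cvgM => //; rewrite mulr2n mulrDl mul1r.
apply: cvgV; first by rewrite gt_eqF// addr_gt0.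
apply: cvgD; last exact: cvg_cst.
apply: continuous_cvg; first exact: sqrt_continuous.
exact: has_tderive_cvg fl.
Qed.

Lemma has_tderive_coord n (f : R -> 'rV[R]_n) l i : has_tderive T f t l ->
  has_tderive T (fun s => f s 0 i : R) t (l 0 i : R).
Proof.
move=> fl; rewrite /has_tderive.
have -> : tquot (fun s => f s 0 i : R) t = (fun s => tquot f t s 0 i).
  by apply/funext => s; rewrite /tquot !mxE.
exact: (cvg_comp _ _ fl (@coord_continuous R 1 n 0 i l)).
Qed.

End time_calculus.

(** * Nodal representation of [Vh] and its closure under pointwise limits *)

Section finite_element_space.
Variables (R : realType) (J : nat).
Hypothesis J_gt0 : (0 < J)%N.
Local Notation rho := (node R J).
Local Notation Vh := (@Vh R J).
Local Notation Vh2 := (@Vh2 R J).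
Implicit Types (f g : R -> R) (x : R) (j : nat).

Lemma nodeSB j : rho j.+1 - rho j = mesh R J.
Proof. by rewrite /node -mulrBl -natrB// subSnn mul1r. Qed.

Lemma mesh_gt0 : 0 < mesh R J.
Proof. by rewrite /mesh invr_gt0 ltr0n. Qed.

Lemma node_ltS j : rho j < rho j.+1.
Proof. by rewrite -subr_gt0 nodeSB mesh_gt0. Qed.

(** Affine coordinate on an element, 0 at its left node and 1 at its right node. *)
Definition theta j x : R := (x - rho j) / (rho j.+1 - rho j).

Lemma theta_itv j x : x \in `[rho j, rho j.+1] -> theta j x \in `[0, 1].
Proof.
have h0 := mesh_gt0.
rewrite /theta nodeSB !in_itv/= => /andP[x1 x2].
apply/andP; split; first by apply: divr_ge0; rewrite ?subr_ge0// ltW.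
by rewrite ler_pdivrMr// mul1r -(nodeSB j) lerB.
Qed.

Lemma Vh_interp f j x : Vh f -> (j < J)%N -> x \in `[rho j, rho j.+1] ->
  f x = (1 - theta j x) * f (rho j) + theta j x * f (rho j.+1).
Proof.
move=> [_ _ aff] jJ xj; have [a [b fE]] := aff j jJ.
have lt := node_ltS j.
rewrite !fE ?bound_itvE ?ltW// /theta; field.
by rewrite subr_eq0 gt_eqF.
Qed.

Lemma periodic_int f (n : int) x : periodic f 1 -> f (x + n%:~R) = f x.
Proof.
move=> pf; have pn m y : f (y + m%:R) = f y.
  by elim: m y => [|m IH] y; rewrite ?addr0// -natr1 addrA pf IH.
case: n => m; first exact: pn.
by rewrite NegzE -[in RHS](subrK m.+1%:R x) pn mulrNz.
Qed.

(* The same j and c serve all f in Vh, which makes pointwise convergence in Vh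
   uniform. *)
Lemma Vh_rep x : exists j (c : R), [/\ (j < J)%N, c \in `[0, 1] &
  forall f, Vh f -> f x = (1 - c) * f (rho j) + c * f (rho j.+1)].
Proof.
(* Periodicity reduces [x] to its fractional part [y]; as y < 1, the integer part of y J is an
   element index below [J]. *)
pose y := x - (Num.floor x)%:~R.
have y0 : 0 <= y by rewrite subr_ge0 Num.Theory.floor_le.
have y1 : y < 1.
  by rewrite ltrBlDl -[X in _ + X]/(1%:~R) -intrD Num.Theory.floorD1_gt.
have hy0 : 0 <= y * J%:R by rewrite mulr_ge0.
pose j := Num.trunc (y * J%:R).
have /andP[jle jgt] := truncn_itv hy0.
have J0 : 0 < J%:R :> R by rewrite ltr0n.
have jJ : (j < J)%N.
  rewrite -(ltr_nat R) (le_lt_trans jle)//.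
  by rewrite gtr_pMl.
have yj : y \in `[rho j, rho j.+1].
  by rewrite in_itv/= /node /mesh ler_pdivrMr// jle/= ler_pdivlMr// ltW.
exists j, (theta j y); split => //; first exact: theta_itv.
move=> f fV; rewrite -(Vh_interp fV jJ yj).
case: fV => pf _ _.
by rewrite -[in LHS](subrK (Num.floor x)%:~R x) periodic_int.
Qed.

(** Stated in the shape of a difference quotient in time. *)
Lemma Vh_scaleB (a : R) f g : Vh f -> Vh g -> Vh (fun x => a * (f x - g x)).
Proof.
move=> [pf cf af] [pg cg ag]; split.
- by move=> x; rewrite pf pg.
- by move=> x; apply: cvgM; [exact: cvg_cst|apply: cvgB; [exact: cf|exact: cg]].
- move=> j jJ; have [a1 [b1 fE]] := af j jJ; have [a2 [b2 gE]] := ag j jJ.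
  exists (a * (a1 - a2)), (a * (b1 - b2)) => x xj.
  by rewrite fE// gE//; ring.
Qed.

(** Periodicity and affinity are linear relations between finitely many values, so they pass to the
    limit. Continuity follows from uniform convergence, which reduces to convergence at the
    nodes. *)
Lemma Vh_cvg (S : Type) (F : set_system S) (FF : ProperFilter F)
    (G : S -> R -> R) (d : R -> R) :
  (\forall s \near F, Vh (G s)) -> (forall x, G s x @[s --> F] --> d x) ->
  Vh d.
Proof.
move=> GV Gd.
(* The coefficient [c] does not depend on [s]. Taking c = 0 and y = z yields periodicity, other
   values of [c] the interpolation formulas. *)
have dE (x y z c : R) :
    (\forall s \near F, G s x = (1 - c) * G s y + c * G s z) ->
    d x = (1 - c) * d y + c * d z.
  move=> near_eq; have H : G s x @[s --> F] --> (1 - c) * d y + c * d z.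
    have : (1 - c) * G s y + c * G s z @[s --> F] --> (1 - c) * d y + c * d z.
      by apply: cvgD; apply: cvgM => //; exact: cvg_cst.
    by apply: cvg_trans; apply: near_eq_cvg; apply: filterS near_eq => s ->.
  exact: (cvg_unique (@Rhausdorff R) (Gd x) H).
split.
- move=> x; rewrite (dE _ x x 0); first by rewrite mul0r addr0 subr0 mul1r.
  by apply: filterS GV => s [pG _ _]; rewrite pG mul0r addr0 subr0 mul1r.
- move=> x0; apply/cvgrPdist_lt => e e0.
  have e3 : 0 < e / 3 by rewrite divr_gt0.
  have unif : \forall s \near F, forall j : 'I_J.+1,
      `|d (rho j) - G s (rho j)| < e / 3.
    apply: filter_forall => j.
    by have /cvgrPdist_lt/(_ _ e3) := Gd (rho j).
  have /filter_ex[s [GsV close]] : \forall s \near F,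
      Vh (G s) /\ forall j : 'I_J.+1, `|d (rho j) - G s (rho j)| < e / 3.
    exact: filterI.
  (* At every point the error is a convex combination of two nodal errors. *)
  have bound x : `|d x - G s x| <= e / 3.
    have [j [c [jJ c01 rep]]] := Vh_rep x.
    rewrite (dE x (rho j) (rho j.+1) c); last first.
      by apply: filterS GV => r /rep.
    rewrite (rep _ GsV).
    have c1 := close (Ordinal (ltnW jJ : (j < J.+1)%N)).
    have c2 := close (Ordinal (jJ : (j.+1 < J.+1)%N)).
    rewrite /= in c1 c2.
    have -> : (1 - c) * d (rho j) + c * d (rho j.+1)
        - ((1 - c) * G s (rho j) + c * G s (rho j.+1))
      = (1 - c) * (d (rho j) - G s (rho j))
        + c * (d (rho j.+1) - G s (rho j.+1)) by ring.
    move: (ltW c1) (ltW c2); rewrite !ler_norml => /andP[? ?] /andP[? ?].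
    move: c01; rewrite in_itv/= => /andP[? ?]; apply/andP; split; nra.
  have [_ /(_ x0)/cvgrPdist_lt/(_ _ e3) cG _] := GsV.
  apply: filterS cG => y Gy.
  have b0 := bound x0; have := bound y.
  rewrite distrC => by_.
  (* The usual three-epsilon splitting through the continuous function [G s]. *)
  have -> : d x0 - d y = (d x0 - G s x0) + (G s x0 - G s y) + (G s y - d y).
    by ring.
  have -> : e = e / 3 + e / 3 + e / 3 by field.
  apply: le_lt_trans (ler_normD _ _) _; apply: ltr_leD => //.
  by apply: le_lt_trans (ler_normD _ _) _; exact: ler_ltD.
- move=> j jJ.
  have lt0 : rho j.+1 - rho j != 0 by rewrite subr_eq0 gt_eqF// node_ltS.
  pose b := (d (rho j.+1) - d (rho j)) / (rho j.+1 - rho j).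
  exists (d (rho j) - rho j * b), b => x xj.
  rewrite (dE x (rho j) (rho j.+1) (theta j x)); last first.
    by apply: filterS GV => s GsV; exact: Vh_interp.
  by rewrite /theta /b; field.
Qed.

(** The factor [J%:R] is 1/h: this is the constant value of X_rho inside the element. *)
Definition slope (X : R -> 'rV[R]_2) j : 'rV[R]_2 :=
  J%:R *: (X (rho j.+1) - X (rho j)).

Lemma Vh2_interp X j x : Vh2 X -> (j < J)%N -> x \in `[rho j, rho j.+1] ->
  X x = (1 - theta j x) *: X (rho j) + theta j x *: X (rho j.+1).
Proof.
move=> XV jJ xj; apply/rowP => i; rewrite !mxE.
exact: (Vh_interp (XV i)).
Qed.

(** For small increments the point stays in the open element, where the difference quotient is
    exactly constant. *)
Lemma derive1_Vh2 X j x : Vh2 X -> (j < J)%N -> x \in `]rho j, rho j.+1[ ->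
  derive1 X x = slope X j.
Proof.
move=> XV jJ xj; rewrite /derive1; apply: cvg_lim => //.
apply: cvg_near_cst; rewrite near_withinE.
have near_x : \forall h \near (0 : R), h + x \in `]rho j, rho j.+1[.
  have : \forall y \near x, y \in `]rho j, rho j.+1[ by exact: near_in_itvoo.
  by rewrite (near_shift 0)/= subr0.
apply: filterS near_x => h hx h0.
rewrite (Vh2_interp XV jJ (subset_itv_oo_cc hx)).
rewrite (Vh2_interp XV jJ (subset_itv_oo_cc xj)).
apply/rowP => i; rewrite !mxE /theta nodeSB /mesh invrK.
by field.
Qed.

End finite_element_space.

(** * The Euclidean inner product of the plane *)

Section vector_algebra.
Variable R : realType.
Implicit Types u v : 'rV[R]_2.

Lemma dotC u v : dot u v = dot v u.
Proof. by rewrite /dot; apply: eq_bigr => i _; rewrite mulrC. Qed.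

Lemma dotZl (a : R) u v : dot (a *: u) v = a * dot u v.
Proof.
by rewrite /dot mulr_sumr; apply: eq_bigr => i _; rewrite !mxE mulrA.
Qed.

Lemma dotZr (a : R) u v : dot u (a *: v) = a * dot u v.
Proof. by rewrite dotC dotZl dotC. Qed.

Lemma dot_ge0 u : 0 <= dot u u.
Proof. by rewrite /dot sumr_ge0// => i _; rewrite -expr2 sqr_ge0. Qed.

Lemma enorm_gt0 u : (0 < enorm u) = (0 < dot u u).
Proof. by rewrite /enorm sqrtr_gt0. Qed.

End vector_algebra.

(** * Time derivatives of finite element functions are finite element functions *)

Section time_derivatives_in_Vh.
Variables (R : realType) (J : nat) (T t : R).
Hypothesis J_gt0 : (0 < J)%N.
Hypothesis tT : t \in `]0, T].
Local Notation rho := (node R J).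

Lemma time_mem : t \in `[0, T].
Proof. by have := tT; rewrite !in_itv/= => /andP[/ltW -> ->]. Qed.

Lemma Vh_has_tderive (g : R -> R -> R) (d : R -> R) :
  {in `[0, T], forall s, Vh J (g s)} ->
  (forall x, has_tderive T (fun s => g s x : R) t (d x : R)) -> Vh J d.
Proof.
move=> gV gd.
apply: (Vh_cvg J_gt0 (time_filter_proper tT)) gd.
apply: near_time => s sT.
by apply: Vh_scaleB; [exact: gV|exact/gV/time_mem].
Qed.

(** Differentiability is given at the nodes only; the value at [x] is a combination of two nodal
    values with time-independent coefficients. *)
Lemma Vh_tderive (g : R -> R -> R) (x : R) :
  {in `[0, T], forall s, Vh J (g s)} ->
  (forall j, (j <= J)%N -> tderivable T (fun s => g s (rho j) : R) t) ->
  has_tderive T (fun s => g s x : R) t (tderive T (fun s => g s x : R) t).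
Proof.
move=> gV dg; have [j [c [jJ _ rep]]] := Vh_rep J_gt0 x.
have H := has_tderiveD
  (has_tderiveZ (a := (1 - c)) (tderivableP (dg j (ltnW jJ))))
  (has_tderiveZ (a := c) (tderivableP (dg j.+1 jJ))).
apply/tderivableP/cvg_ex; eexists.
by apply: has_tderive_eq H => // s sT; rewrite (rep _ (gV _ sT)).
Qed.

Lemma Vh2_tderive (X : R -> R -> 'rV[R]_2) (x : R) :
  {in `[0, T], forall s, Vh2 J (X s)} ->
  (forall j, (j <= J)%N -> tderivable T (fun s => X s (rho j)) t) ->
  has_tderive T (fun s => X s x) t (tderive T (fun s => X s x) t).
Proof.
move=> XV dX; have [j [c [jJ _ rep]]] := Vh_rep J_gt0 x.
have H := has_tderiveD
  (has_tderiveZ (a := (1 - c)) (tderivableP (dX j (ltnW jJ))))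
  (has_tderiveZ (a := c) (tderivableP (dX j.+1 jJ))).
apply/tderivableP/cvg_ex; eexists.
apply: has_tderive_eq H => // s sT; apply/rowP => i.
by rewrite !mxE [RHS](rep _ (XV _ sT i)).
Qed.

Lemma Vh2_has_tderive (X : R -> R -> 'rV[R]_2) (d : R -> 'rV[R]_2) :
  {in `[0, T], forall s, Vh2 J (X s)} ->
  (forall x, has_tderive T (fun s => X s x) t (d x)) -> Vh2 J d.
Proof.
move=> XV Xd i; apply: (Vh_has_tderive (g := fun s x => X s x 0 i)).
  by move=> s sT; exact: XV.
by move=> x; exact: has_tderive_coord.
Qed.

End time_derivatives_in_Vh.

(** * The integrals of the scheme as sums over elements of nodal expressions *)

Section elementwise_formulas.
Variables (R : realType) (J : nat).
Hypothesis J_gt0 : (0 < J)%N.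
Local Notation rho := (node R J).

(* the integral of f g over the element of index j, for f and g in Vh *)
Definition mass (j : nat) (f g : R -> R) : R :=
  mesh R J / 6 * (2 * f (rho j) * g (rho j) + f (rho j) * g (rho j.+1)
                  + f (rho j.+1) * g (rho j) + 2 * f (rho j.+1) * g (rho j.+1)).

Lemma Vh_cst (a : R) : Vh J (fun=> a).
Proof.
split=> [//||j _]; first exact: cst_continuous.
by exists a, 0 => x _; rewrite mul0r addr0.
Qed.

(** Common form of the integrals to be differentiated or compared: a constant per element, coming
    from X_rho, times two functions of [Vh]. *)
Lemma integral01_mass (f g : R -> R) (c : nat -> R) (w : R -> R) :
  Vh J f -> Vh J g ->
  (forall j, (j < J)%N ->
    {in `]rho j, rho j.+1[, forall x, w x = c j * f x * g x}) ->
  integral01 w = \sum_(j < J) c j * mass j f g.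
Proof.
move=> fV gV wE.
apply: (@integral01_elements _ J w (fun j => c j * mass j f g)) => // j jJ.
rewrite /mass -(@nodeSB R J j) !(mulrA (c j)).
apply: has_integral_affine2; first exact: node_ltS.
move=> x xj; rewrite (wE j jJ x xj).
have xj' := subset_itv_oo_cc xj.
by rewrite (Vh_interp J_gt0 fV jJ xj') (Vh_interp J_gt0 gV jJ xj').
Qed.

Definition element_speed (X : R -> 'rV[R]_2) (j : nat) : R :=
  enorm (slope J X j).

Lemma speed_element (X : R -> 'rV[R]_2) j x : Vh2 J X -> (j < J)%N ->
  x \in `]rho j, rho j.+1[ -> speed X x = element_speed X j.
Proof. by move=> XV jJ xj; rewrite /speed (derive1_Vh2 J_gt0 XV jJ xj). Qed.

(* d|X_rho|/dt = tau . [X_t]_rho on the element of index j *)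
Definition stretch (X Y : R -> 'rV[R]_2) (j : nat) : R :=
  dot (slope J X j) (slope J Y j) / element_speed X j.

Lemma ip_weight (X : R -> 'rV[R]_2) (f g : R -> R) :
  Vh2 J X -> Vh J f -> Vh J g ->
  ip f (fun x => g x * speed X x)
  = \sum_(j < J) element_speed X j * mass j f g.
Proof.
move=> XV fV gV; apply: integral01_mass => // j jJ x xj.
by rewrite (speed_element XV jJ xj); ring.
Qed.

Lemma ip_sqr_speed (X : R -> 'rV[R]_2) (f : R -> R) : Vh2 J X -> Vh J f ->
  ip (fun x => f x ^+ 2) (speed X)
  = \sum_(j < J) element_speed X j * mass j f f.
Proof.
move=> XV fV; apply: integral01_mass => // j jJ x xj.
by rewrite (speed_element XV jJ xj); ring.
Qed.

Lemma curve_length_elements (X : R -> 'rV[R]_2) : Vh2 J X ->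
  curve_length X = \sum_(j < J) element_speed X j * mesh R J.
Proof.
move=> XV; rewrite /curve_length.
(* With both factors equal to 1, [mass] reduces to the element length h. *)
rewrite (@integral01_mass (fun=> 1) (fun=> 1) (element_speed X))//.
- by apply: eq_bigr => j _; rewrite /mass; field.
- exact: Vh_cst.
- exact: Vh_cst.
- by move=> j jJ x xj; rewrite !mulr1 (speed_element XV jJ xj).
Qed.

Lemma ip_stretch (X Y : R -> 'rV[R]_2) (f g : R -> R) :
  Vh2 J X -> Vh2 J Y -> Vh J f -> Vh J g ->
  ip (fun x => dot (derive1 Y x) (tangent X x)) (fun x => f x * g x)
  = \sum_(j < J) stretch X Y j * mass j f g.
Proof.
move=> XV YV fV gV; apply: integral01_mass => // j jJ x xj.
rewrite /tangent (speed_element XV jJ xj) !(derive1_Vh2 J_gt0 _ jJ xj)//.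
by rewrite dotZr dotC /stretch; ring.
Qed.

Lemma vip_stretch (X Y : R -> 'rV[R]_2) : Vh2 J X -> Vh2 J Y ->
  vip (derive1 X) (fun x => (speed X x)^-1 *: derive1 Y x)
  = \sum_(j < J) stretch X Y j * mesh R J.
Proof.
move=> XV YV; rewrite /vip.
rewrite (@integral01_mass (fun=> 1) (fun=> 1) (stretch X Y))//.
- by apply: eq_bigr => j _; rewrite /mass; field.
- exact: Vh_cst.
- exact: Vh_cst.
- move=> j jJ x xj; rewrite !mulr1 (speed_element XV jJ xj).
  rewrite !(derive1_Vh2 J_gt0 _ jJ xj)//.
  by rewrite dotZr /stretch; ring.
Qed.

End elementwise_formulas.

(** * Time derivative of the discrete energy *)

Section energy.
Variables (R : realType) (J : nat) (lambda T t : R).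
Hypothesis J_gt0 : (0 < J)%N.
Hypothesis tT : t \in `]0, T].
Local Notation rho := (node R J).
Variables (X : R -> R -> 'rV[R]_2) (X_t : R -> 'rV[R]_2).
Variables (v : R -> R -> R) (v_t : R -> R).
Hypothesis XV : {in `[0, T], forall s, Vh2 J (X s)}.
Hypothesis vV : {in `[0, T], forall s, Vh J (v s)}.
Hypothesis dX : forall x, has_tderive T (fun s => X s x) t (X_t x).
Hypothesis dv : forall x, has_tderive T (fun s => v s x : R) t (v_t x : R).
Hypothesis Xreg : regular J (X t).

Lemma has_tderive_slope j :
  has_tderive T (fun s => slope J (X s) j) t (slope J X_t j).
Proof. by apply: has_tderiveZ => //; apply: has_tderiveB. Qed.

Lemma has_tderive_element_speed j : (j < J)%N ->
  has_tderive T (fun s => element_speed J (X s) j : R) t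
    (stretch J (X t) X_t j : R).
Proof.
move=> jJ; have tT' := time_mem tT.
(* Regularity gives positive speed inside elements, so it is evaluated at the midpoint. *)
have mid : (rho j + rho j.+1) / 2 \in `]rho j, rho j.+1[.
  by rewrite in_itv/= !midf_lt ?node_ltS.
have pos : 0 < dot (slope J (X t) j) (slope J (X t) j).
  rewrite -enorm_gt0 -[enorm _]/(element_speed J (X t) j).
  by rewrite -(speed_element J_gt0 (XV tT') jJ mid); exact: Xreg jJ _ mid.
have D : has_tderive T (fun s => dot (slope J (X s) j) (slope J (X s) j) : R) t
    (2 * dot (slope J (X t) j) (slope J X_t j) : R).
  have -> : 2 * dot (slope J (X t) j) (slope J X_t j) = \sum_(i < 2)
      (slope J X_t j 0 i * slope J (X t) j 0 i
       + slope J (X t) j 0 i * slope J X_t j 0 i).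
    by rewrite /dot mulr_sumr; apply: eq_bigr => i _; ring.
  refine (has_tderive_sum _) => i.
  have Dj := has_tderive_coord (i := i) (@has_tderive_slope j).
  exact: (has_tderiveM Dj Dj).
have := has_tderive_sqrt (fun s => dot_ge0 _) pos D.
by rewrite -mulf_div divff ?mul1r.
Qed.

(** The derivative is written back in integrals so that its first two terms form the left side of
    the second equation of (S) tested with [v], and its last one is [lambda] times minus the right
    side of the fourth tested with [X_t]. *)
Lemma has_tderive_energy :
  has_tderive T
    (fun s => 2^-1 * ip (fun x => v s x ^+ 2) (speed (X s))
              + lambda * curve_length (X s) : R) t
    ((ip v_t (fun x => v t x * speed (X t) x)
      + 2^-1 * ip (fun x => dot (derive1 X_t x) (tangent (X t) x))
                  (fun x => v t x * v t x))
     + lambda * vip (derive1 (X t))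
                    (fun x => (speed (X t) x)^-1 *: derive1 X_t x) : R).
Proof.
have tT' := time_mem tT.
have XtV : Vh2 J X_t := Vh2_has_tderive J_gt0 tT XV dX.
have vtV : Vh J v_t := Vh_has_tderive J_gt0 tT vV dv.
have XV' := XV tT'; have vV' := vV tT'.
rewrite (ip_weight J_gt0 XV' vtV vV') (ip_stretch J_gt0 XV' XtV vV' vV').
rewrite (vip_stretch J_gt0 XV' XtV).
rewrite !mulr_sumr -!big_split/=.
pose E (s : R) : R := \sum_(j < J)
  (2^-1 * (element_speed J (X s) j * mass J j (v s) (v s))
   + lambda * (element_speed J (X s) j * mesh R J)).
apply: (@has_tderive_eq _ _ _ tT _ E).
  move=> s sT; rewrite /E (ip_sqr_speed J_gt0 (XV sT) (vV sT)).
  rewrite (curve_length_elements J_gt0 (XV sT)).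
  by rewrite !mulr_sumr -big_split.
refine (has_tderive_sum _) => j.
have Dq := has_tderive_element_speed (ltn_ord j).
have Dv a b := has_tderiveM (@dv a) (@dv b).
(* [mass] is bilinear and symmetric, whence the factor 2. *)
have Dm : has_tderive T (fun s => mass J j (v s) (v s) : R) t
    (2 * mass J j v_t (v t) : R).
  have H := has_tderiveZ (a := mesh R J / 6)
    (has_tderiveD (has_tderiveD (has_tderiveD
      (has_tderiveZ (a := 2) (@Dv (rho j) (rho j)))
      (@Dv (rho j) (rho j.+1)))
      (@Dv (rho j.+1) (rho j)))
      (has_tderiveZ (a := 2) (@Dv (rho j.+1) (rho j.+1)))).
  have -> : 2 * mass J j v_t (v t) = mesh R J / 6 *
    (2 * (v_t (rho j) * v t (rho j) + v t (rho j) * v_t (rho j))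
     + (v_t (rho j) * v t (rho j.+1) + v t (rho j) * v_t (rho j.+1))
     + (v_t (rho j.+1) * v t (rho j) + v t (rho j.+1) * v_t (rho j))
     + 2 * (v_t (rho j.+1) * v t (rho j.+1) + v t (rho j.+1) * v_t (rho j.+1))).
    by rewrite /mass; ring.
  by apply: has_tderive_eq H => // s _; rewrite /mass /GRing.scale/= !mulrA.
have Dqm := has_tderiveM Dq Dm.
have H := has_tderiveD (has_tderiveZ (a := 2^-1) Dqm)
  (has_tderiveZ (a := (lambda * mesh R J)) Dq).
have -> : element_speed J (X t) j * mass J j v_t (v t)
    + 2^-1 * (stretch J (X t) X_t j * mass J j (v t) (v t))
    + lambda * (stretch J (X t) X_t j * mesh R J)
  = 2^-1 * (stretch J (X t) X_t j * mass J j (v t) (v t)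
            + element_speed J (X t) j * (2 * mass J j v_t (v t)))
    + lambda * mesh R J * stretch J (X t) X_t j by field.
by apply: has_tderive_eq H => // s _; rewrite /GRing.scale/=; ring.
Qed.

End energy.

(** * Rearranging inner products and testing the scheme *)

Lemma eq_ip (R : realType) (f g f' g' : R -> R) :
  (forall x, f x * g x = f' x * g' x) -> ip f g = ip f' g'.
Proof. by move=> H; rewrite /ip; congr integral01; apply/funext. Qed.

Lemma ip_ge0 (R : realType) (f g : R -> R) :
  (forall x, 0 <= f x * g x) -> 0 <= ip f g.
Proof. by move=> H; apply: Rintegral_ge0. Qed.

Lemma ip_0 (R : realType) (f g : R -> R) : (forall x, g x = 0) -> ip f g = 0.
Proof.
move=> g0; rewrite (@eq_ip _ _ _ (fun=> 0) (fun=> 0)).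
  by rewrite /ip /integral01; under eq_Rintegral do rewrite mulr0;
     rewrite /Rintegral integral0.
by move=> x; rewrite g0 !mulr0.
Qed.

Theorem theorem2 (R : realType) (J : nat) (hJ : (0 < J)%N)
    (lambda : R) (hlambda : 0 <= lambda) (T : R) (hT : 0 < T)
    (X0 : R -> 'rV[R]_2) (hX0 : Vh2 J X0) (vk0 : R -> R) (hvk0 : Vh J vk0)
    (VV vk : R -> R -> R) (X : R -> R -> 'rV[R]_2) (k : R -> R -> R)
    (hsol : semidiscrete_solution J lambda T X0 vk0 VV vk X k)
    (hreg : forall t : R, t \in `[0, T] -> regular J (X t)) :
  forall t : R, t \in `]0, T] ->
    has_tderive T
      (fun s => 2^-1 * ip (fun x => vk s x ^+ 2) (speed (X s))
                + lambda * curve_length (X s) : R) t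
      (- ip (VV t) (fun x => VV t x * speed (X t) x))
    /\ - ip (VV t) (fun x => VV t x * speed (X t) x) <= 0.
Proof.
move=> t tT; split; last first.
  rewrite oppr_le0; apply: ip_ge0 => x.
  by rewrite mulrA -expr2 mulr_ge0 ?sqr_ge0// /speed sqrtr_ge0.
case: hsol => X_init vk_init VVV vkV XV kV dX dvk.
move=> velocity curvature motion equi.
(* (S) speaks of positive times only; membership in the finite element spaces at time 0 comes from
   the initial data. *)
have mem_pos s : s \in `[0, T] -> s = 0 \/ s \in `]0, T].
  rewrite !in_itv/= => /andP[]; rewrite le_eqVlt => /predU1P[->|-> ->].
    by left.
  by right.
have XV' : {in `[0, T], forall s, Vh2 J (X s)}.
  by move=> s /mem_pos[->|]; [rewrite X_init|exact: XV].
have vkV' : {in `[0, T], forall s, Vh J (vk s)}.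
  by move=> s /mem_pos[->|]; [rewrite vk_init|exact: vkV].
pose X_t x := tderive T (fun s => X s x) t.
pose vk_t x : R := tderive T (fun s => vk s x : R) t.
have dXt x : has_tderive T (fun s => X s x) t (X_t x).
  by apply: (Vh2_tderive hJ tT) => // j jJ; exact: dX.
have dvkt x : has_tderive T (fun s => vk s x : R) t (vk_t x : R).
  by apply: (Vh_tderive hJ tT) => // j jJ; exact: dvk.
have XtV : Vh2 J X_t := Vh2_has_tderive hJ tT XV' dXt.
have := has_tderive_energy (lambda := lambda) hJ tT XV' vkV' dXt dvkt
  (@hreg t (time_mem tT)).
have /= := curvature t tT _ (vkV t tT).
rewrite -/X_t -/vk_t => ->.
(* With the test function equal to [vk t], the antisymmetric tangential term vanishes. *)
rewrite [X in _ + 2^-1 * X]ip_0; last by move=> x; rewrite mulrC subrr.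
(* The fourth equation with [X_t] and the third with [k t] have the same lumped integrand pointwise,
   so no one-sided limit has to be computed. *)
have length_eq :
    vip (derive1 (X t)) (fun x => (speed (X t) x)^-1 *: derive1 X_t x)
    = - ip (VV t) (fun x => k t x * speed (X t) x).
  rewrite -(motion t tT _ (kV t tT)) -[LHS]opprK -(equi t tT _ XtV).
  congr (- _); rewrite /vip_h /ip_h; congr lumped; apply/funext => x.
  by rewrite dotZl dotZr; ring.
rewrite length_eq mulr0 addr0.
have vel := velocity t tT _ (VVV t tT).
(* Factors are moved between the two slots until the three terms match those of the first equation
   tested with [VV t]. *)
rewrite (@eq_ip _ (derive1 (VV t)) _ (derive1 (vk t))
  (fun x => derive1 (VV t) x * (speed (X t) x)^-1)); last by move=> x; ring.
rewrite (@eq_ip _ (fun x => VV t x * vk t x ^+ 2) _ (fun x => vk t x ^+ 3)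
  (fun x => VV t x * speed (X t) x)); last by move=> x; ring.
rewrite (@eq_ip _ (VV t) (fun x => k t x * speed (X t) x) (k t)
  (fun x => VV t x * speed (X t) x)); last by move=> x; ring.
set a := ip (derive1 (vk t)) _ in vel *.
set b := ip (fun x => vk t x ^+ 3) _ in vel *.
set c := ip (k t) _ in vel *.
(* The remaining sum - a + b/2 - lambda c is minus the right side of the first equation, hence minus
   the dissipation. *)
by rewrite vel (_ : - (_ + _) = - a + 2^-1 * b + lambda * - c)//; ring.
Qed.
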